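(* Let $\mathcal{G}_b=(\mathcal{A}_b\cup\mathcal{B}_b,\mathcal{E}_b)$ be a bipartite graph with edge weights $w:\mathcal{E}_b\to\mathbb{R}$, and let $\mathcal{M}$ be a maximum cardinality matching (MCM) of $\mathcal{G}_b$. If $\mathcal{M}$ is the unique solution to the Sequential Bottleneck Assignment Problem (SeqBAP) for $\mathcal{G}_b$, then $\mathcal{M}$ is also the unique solution to the Lexicographic Bottleneck Assignment Problem (LexBAP) for $\mathcal{G}_b$.
   Context: Setting: $\mathcal{G}_b=(\mathcal{V}_b,\mathcal{E}_b)$ is a finite undirected bipartite graph with $\mathcal{V}_b=\mathcal{A}_b\cup\mathcal{B}_b$, $\mathcal{A}_b\cap\mathcal{B}_b=\emptyset$, $\emptyset\neq\mathcal{E}_b\subseteq\{\{i,j\}\mid i\in\mathcal{A}_b,j\in\mathcal{B}_b\}$, and weights $w:\mathcal{E}_b\to\mathbb{R}$. A matching is a set of edges no two of which share a vertex; an MCM is a matching of maximum cardinality. $\mathcal{C}(\mathcal{G})$ is the set of MCMs of $\mathcal{G}$, $\mathcal{F}(\mathcal{G})$ is the cardinality of an MCM of $\mathcal{G}$, and $n=\mathcal{F}(\mathcal{G}_b)$. Ordered weights: for an MCM $\mathcal{M}$, $\mathcal{T}(\mathcal{M})=(\mathcal{T}_1(\mathcal{M}),\dots,\mathcal{T}_n(\mathcal{M}))$ is the tuple of weights of the edges of $\mathcal{M}$ arranged in non-increasing order. LexBAP: an MCM $\mathcal{M}$ is a solution if for every $\mathcal{M}'\in\mathcal{C}(\mathcal{G}_b)$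 with $\mathcal{T}(\mathcal{M}')\neq\mathcal{T}(\mathcal{M})$ there is $k\in\{1,\dots,n\}$ such that $\mathcal{T}_k(\mathcal{M})<\mathcal{T}_k(\mathcal{M}')$ and $\mathcal{T}_l(\mathcal{M})=\mathcal{T}_l(\mathcal{M}')$ for all positive integers $l<k$. Bottleneck weight: $\mathcal{W}(\mathcal{G})=\min_{\mathcal{M}\in\mathcal{C}(\mathcal{G})}\max_{e\in\mathcal{M}}w(e)$. Price of absence: for a graph $\mathcal{G}=(\mathcal{V},\mathcal{E})$ and $e\in\mathcal{E}$, $P(\mathcal{G},e)=\mathcal{W}((\mathcal{V},\mathcal{E}\setminus\{e\}))-\mathcal{W}((\mathcal{V},\mathcal{E}))$ if $\mathcal{F}((\mathcal{V},\mathcal{E}))=\mathcal{F}((\mathcal{V},\mathcal{E}\setminus\{e\}))$, and $P(\mathcal{G},e)=+\infty$ otherwise. For a set of edges $\mathcal{E}$, $\mathcal{L}(\mathcal{E})=\arg\max_{e\in\mathcal{E}}w(e)$ (the set of all maximisers). SeqBAP: an MCM $\mathcal{M}\in\mathcal{C}(\mathcal{G}_b)$ is a solution if its edges can be labelled $\{i_1,j_1\},\dots,\{i_n,j_n\}$ (with $i_k\in\mathcal{A}_b$, $j_k\in\mathcal{B}_b$) and there are matchings $\mathcal{M}^1,\dots,\mathcal{M}^n$ such that, with $\mathcal{A}^1=\mathcal{A}_b$, $\mathcal{B}^1=\mathcal{B}_b$, $\mathcal{A}^k=\mathcal{A}^{k-1}\setminus\{i_{k-1}\}$, $\mathcal{B}^k=\mathcal{B}^{k-1}\setminus\{j_{k-1}\}$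 for $2\le k\le n$, $\mathcal{E}^k=\{\{i,j\}\in\mathcal{E}_b\mid i\in\mathcal{A}^k,j\in\mathcal{B}^k\}$ and $\mathcal{G}^k=(\mathcal{A}^k\cup\mathcal{B}^k,\mathcal{E}^k)$, for every $k\in\{1,\dots,n\}$: $\mathcal{M}^k\in\arg\min_{\mathcal{M}'\in\mathcal{C}(\mathcal{G}^k)}\max_{e\in\mathcal{M}'}w(e)$ and $\{i_k,j_k\}\in\arg\max_{e\in\mathcal{L}(\mathcal{M}^k)}P(\mathcal{G}^k,e)$. Uniqueness of a solution refers to the MCM as a set of edges. *)

(* Defs.v *)
From HB Require Import structures.
From mathcomp Require Import all_boot all_order all_algebra.
From mathcomp Require Import reals constructive_ereal.

Set Implicit Arguments.
Unset Strict Implicit.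
Unset Printing Implicit Defensive.

Import Order.TTheory GRing.Theory Num.Theory.
Local Open Scope ring_scope.

(* An undirected edge is the set of its two endpoints. Matchings and all the  *)
(* notions built on them depend on a graph only through its edge set, so a    *)
(* graph is represented by its set of edges E. Weights are total functions on *)
(* {set V}, of which only the values on the edges are ever used.              *)

Definition is_matching (V : finType) (E M : {set {set V}}) : bool :=
  (M \subset E) && trivIset M.

Definition mcm_card (V : finType) (E : {set {set V}}) : nat :=
  \max_(M : {set {set V}} | is_matching E M) #|M|.

Definition mcms (V : finType) (E : {set {set V}}) : {set {set {set V}}} :=
  [set M : {set {set V}} | is_matching E M & #|M| == mcm_card E].

Definition ordered_weights (R : realType) (V : finType) (w : {set V} -> R)
    (M : {set {set V}}) : seq R :=
  sort >=%R [seq w e | e in M].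

(* Positions are numbered from 0. *)
Definition is_LexBAP (R : realType) (V : finType) (E : {set {set V}})
    (w : {set V} -> R) (M : {set {set V}}) : Prop :=
  M \in mcms E /\
  forall M', M' \in mcms E -> ordered_weights w M' <> ordered_weights w M ->
    exists k : nat,
      [/\ (k < mcm_card E)%N,
          nth 0 (ordered_weights w M) k < nth 0 (ordered_weights w M') k &
          forall l : nat, (l < k)%N ->
            nth 0 (ordered_weights w M) l = nth 0 (ordered_weights w M') l].

(* The maximum over an empty matching is -oo; a graph with at least one edge  *)
(* has no empty maximum cardinality matching, so its bottleneck weight is     *)
(* finite.                                                                    *)
Definition max_weight (R : realType) (V : finType) (w : {set V} -> R)
    (M : {set {set V}}) : \bar R :=
  \big[Order.max/-oo%E]_(e in M) (w e)%:E.

Definition bottleneck_weight (R : realType) (V : finType)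
    (w : {set V} -> R) (E : {set {set V}}) : \bar R :=
  \big[Order.min/+oo%E]_(M in mcms E) max_weight w M.

Definition bottleneck_mcms (R : realType) (V : finType)
    (w : {set V} -> R) (E : {set {set V}}) : {set {set {set V}}} :=
  [set M in mcms E |
    [forall M' in mcms E, (max_weight w M <= max_weight w M')%E]].

Definition price_of_absence (R : realType) (V : finType)
    (w : {set V} -> R) (E : {set {set V}}) (e : {set V}) : \bar R :=
  if mcm_card E == mcm_card (E :\ e)
  then (bottleneck_weight w (E :\ e) - bottleneck_weight w E)%E
  else +oo%E.

Definition heaviest_edges (R : realType) (V : finType) (w : {set V} -> R)
    (E : {set {set V}}) : {set {set V}} :=
  [set e in E | [forall f in E, w f <= w e]].

Definition priciest_edges (R : realType) (V : finType) (w : {set V} -> R)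
    (E M : {set {set V}}) : {set {set V}} :=
  [set e in heaviest_edges w M |
    [forall f in heaviest_edges w M,
      (price_of_absence w E f <= price_of_absence w E e)%E]].

Fixpoint remaining (V : finType) (A : {set V}) (x : nat -> V) (k : nat)
    : {set V} :=
  if k is k'.+1 then remaining A x k' :\ x k' else A.

Definition remaining_edges (V : finType) (A B : {set V}) (E : {set {set V}})
    (i j : nat -> V) (k : nat) : {set {set V}} :=
  [set [set a; b] | a in remaining A i k, b in remaining B j k
                    & [set a; b] \in E].

(* Steps are numbered from 0, and only the values of i, j and Mk below n are  *)
(* relevant. The labelling of M by k < n is bijective because #|M| = n.       *)
Definition is_SeqBAP (R : realType) (V : finType) (A B : {set V})
    (E : {set {set V}}) (w : {set V} -> R) (M : {set {set V}}) : Prop :=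
  let n := mcm_card E in
  M \in mcms E /\
  exists (i j : nat -> V) (Mk : nat -> {set {set V}}),
    M = [set [set i k; j k] | k : 'I_n] /\
    forall k : nat, (k < n)%N ->
      let Ek := remaining_edges A B E i j k in
      [/\ i k \in A, j k \in B,
          Mk k \in bottleneck_mcms w Ek &
          [set i k; j k] \in priciest_edges w Ek (Mk k)].

(* Main.v *)
Require Import Defs.
From mathcomp Require Import all_boot all_order all_algebra.
From mathcomp Require Import reals constructive_ereal.

Set Implicit Arguments.
Unset Strict Implicit.
Unset Printing Implicit Defensive.

Import Order.TTheory GRing.Theory Num.Theory.

(* Every LexBAP solution M is a SeqBAP solution: one may take for the k-th    *)
(* bottleneck matching what is left of M itself. A lexicographic minimiser is *)
(* a bottleneck matching, so the next edge may be chosen as a priciest        *)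
(* heaviest edge of M, and removing a heaviest edge of M with its endpoints   *)
(* leaves a lexicographic minimiser of the smaller graph. Since a LexBAP      *)
(* solution exists, uniqueness for SeqBAP implies uniqueness for LexBAP.      *)

(** The heart is an exchange argument, [lex_minimal_avoiding]. Let [e = [set a; b]] be a heaviest
    edge of a lexicographic minimiser [M], and let [M'] be an MCM of the graph without [a] and [b],
    so that [e |: M'] is an MCM of the whole graph. If no weight in [M'] exceeds [w e], the tuples
    of [M] and [e |: M'] both start with [w e]; cancelling it shows that [M :\ e] does at least as
    well as [M']. Otherwise the tuple of [M'] starts above [w e], hence above every weight of
    [M :\ e]. Since any heaviest edge of [M] will do, the price of absence may select among them,
    and [lex_minimal_SeqBAP] follows by induction on [#|M|]. *)

Section SeqLexi.
Local Open Scope ring_scope.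

(** Turns the first-difference condition of LexBAP into the library's total order, so that
    minimisers can be taken. Equal sizes exclude proper prefixes. *)
Lemma seqlexi_leP (R : realType) (s t : seq R) : size s = size t ->
  (s <= t :> seqlexi R)%O <->
  (t <> s -> exists k : nat,
     [/\ (k < size s)%N, nth 0 s k < nth 0 t k &
         forall l : nat, (l < k)%N -> nth 0 s l = nth 0 t l]).
Proof.
elim: s t => [|x s IHs] [|y t] //= [sz_st]; rewrite Order.SeqLexiOrder.lexi_cons.
split=> [/andP[le_xy /implyP le_st] neq | first_diff].
  move: le_xy; rewrite le_eqVlt => /predU1P[eq_xy | lt_xy]; last by exists 0%N.
  move: le_st neq; rewrite eq_xy lexx => /(_ isT)/(IHs _ sz_st) st_diff neq.
  have [|k [lt_k lt_nth eq_nth]] := st_diff; first by move=> eq_ts; apply: neq; rewrite eq_ts.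
  by exists k.+1; split=> // -[|l] //; apply: eq_nth.
have [eq_xs|neq_ys] := eqVneq (y :: t) (x :: s).
  by case: eq_xs => -> ->; rewrite !lexx.
(* A first difference at position 0 decides the comparison; a later one forces equal heads and
   passes to the tails. *)
have [[|k] [lt_k lt_nth eq_nth]] := first_diff (elimN eqP neq_ys).
  by rewrite (ltW lt_nth) leNgt lt_nth.
have eq_xy : x = y by apply: (eq_nth 0%N).
rewrite eq_xy lexx /=; apply/IHs => // _.
by exists k; split=> // l lt_lk; apply: (eq_nth l.+1).
Qed.

End SeqLexi.

(** * Ordered weights and heaviest edges *)

Section OrderedWeights.
Local Open Scope ring_scope.
Variables (R : realType) (V : finType) (w : {set V} -> R).
Implicit Types (M : {set {set V}}) (e : {set V}).

Lemma size_ordered_weights M : size (ordered_weights w M) = #|M|.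
Proof. by rewrite size_sort size_map cardE. Qed.

Lemma heaviest_edgesP M e :
  reflect (e \in M /\ forall f, f \in M -> w f <= w e) (e \in heaviest_edges w M).
Proof.
rewrite inE; apply: (iffP andP) => -[eM].
  by move/forall_inP.
by move=> le_e; split=> //; apply/forall_inP.
Qed.

Lemma heaviest_edge_exists M : M != set0 -> exists e, e \in heaviest_edges w M.
Proof.
case/set0Pn=> e0 e0M; case: (@Order.TotalTheory.arg_maxP _ _ _ e0 (mem M) w e0M).
by move=> e eM le_e; exists e; apply/heaviest_edgesP.
Qed.

(** Both sides are sorted and are permutations of each other, and a sorted arrangement is unique.
    This recursion drives all comparisons of tuples below. *)
Lemma ordered_weights_heaviest M e : e \in heaviest_edges w M ->
  ordered_weights w M = w e :: ordered_weights w (M :\ e).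
Proof.
case/heaviest_edgesP=> eM le_e.
have ge_total : total (>=%R : rel R) by move=> x y; apply: le_total.
apply: (sorted_eq ge_trans ge_anti).
- exact: sort_sorted.
- rewrite /= path_sortedE; last exact: ge_trans.
  rewrite sort_sorted // andbT all_sort.
  apply/allP=> _ /mapP[f f_M ->] /=.
  by move: f_M; rewrite mem_enum => /setD1P[_ fM]; apply: le_e.
- rewrite perm_sort perm_sym.
  (* The inner sort is undone up to permutation, which leaves [e :: enum (M :\ e)] to be compared
     with [enum M]. *)
  have /permPl <- : perm_eq (w e :: [seq w f | f in M :\ e])
                            (w e :: ordered_weights w (M :\ e)).
    by rewrite perm_cons perm_sym perm_sort.
  apply: (perm_map w (s := e :: enum (M :\ e))); apply: uniq_perm.
  + by rewrite /= mem_enum !inE eqxx enum_uniq.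
  + exact: enum_uniq.
  + by move=> f; rewrite in_cons !mem_enum !inE; case: eqP => //= ->; rewrite eM.
Qed.

Lemma max_weight_heaviest M e : e \in heaviest_edges w M ->
  max_weight w M = (w e)%:E.
Proof.
case/heaviest_edgesP=> eM le_e; apply/le_anti/andP; split.
  by apply/bigmax_leP; split=> [|f fM]; rewrite ?leNye // lee_fin le_e.
exact: (le_bigmax_cond _ (fun f => (w f)%:E) eM).
Qed.

Lemma priciest_edge_exists E M : M != set0 -> exists e, e \in priciest_edges w E M.
Proof.
case/heaviest_edge_exists=> e0 e0M.
case: (@Order.TotalTheory.arg_maxP _ _ _ e0 (mem (heaviest_edges w M))
         (price_of_absence w E) e0M) => e eM le_e.
by exists e; rewrite inE; apply/andP; split; last apply/forall_inP.
Qed.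

End OrderedWeights.

(** * Maximum cardinality matchings *)

Section Matchings.
Variable V : finType.
Implicit Types (E M : {set {set V}}).

Lemma leq_mcm_card E M : is_matching E M -> #|M| <= mcm_card E.
Proof. by move=> matM; exact: (@leq_bigmax_cond _ (is_matching E) (fun M => #|M|)). Qed.

Lemma mcms_exists E : exists M, M \in mcms E.
Proof.
have mat0 : is_matching E set0 by rewrite /is_matching sub0set; apply/trivIsetP=> ? ?; rewrite inE.
have [|M matM cardM] := @eq_bigmax_cond _ (is_matching E) (fun M => #|M|).
  by apply/card_gt0P; exists set0.
by exists M; rewrite inE /mcm_card cardM eqxx andbT.
Qed.

Lemma mcms_matching E M : M \in mcms E -> is_matching E M.
Proof. by rewrite inE => /andP[]. Qed.

Lemma mcms_card E M : M \in mcms E -> #|M| = mcm_card E.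
Proof. by rewrite inE => /andP[_ /eqP]. Qed.

End Matchings.

(** * Removing the endpoints of an edge *)

Section Remaining.
Variable V : finType.
Implicit Types (A B : {set V}) (E M : {set {set V}}) (i j : nat -> V).

Definition prepend (x : V) (i : nat -> V) (k : nat) : V :=
  if k is k'.+1 then i k' else x.

Lemma remaining_sub A i k : remaining A i k \subset A.
Proof. by elim: k => //= k; apply: subset_trans (subsetDl _ _). Qed.

Lemma remaining_prepend A x i k :
  remaining A (prepend x i) k.+1 = remaining (A :\ x) i k.
Proof. by elim: k => //= k <-. Qed.

Lemma remaining_edges0 A B E i j : E \subset [set [set a; b] | a in A, b in B] ->
  remaining_edges A B E i j 0 = E.
Proof.
move=> hE; apply/setP=> f; apply/imset2P/idP => [[a b _] | fE].
  by rewrite inE => /andP[_ abE] ->.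
have /imset2P[a b aA bB f_ab] := subsetP hE f fE.
by exists a b => //; rewrite inE bB -f_ab.
Qed.

(** The graph after the first SeqBAP step, written as step 0 on the shrunken vertex sets so that it
    has the same shape as every later graph. *)
Definition avoiding A B E a b : {set {set V}} :=
  remaining_edges (A :\ a) (B :\ b) E (fun=> a) (fun=> b) 0.

(** Lets a run on the smaller graph be read as the tail of a run that first picks [a] and [b]. *)
Lemma remaining_edges_prepend A B E a b i j k :
  remaining_edges A B E (prepend a i) (prepend b j) k.+1 =
  remaining_edges (A :\ a) (B :\ b) (avoiding A B E a b) i j k.
Proof.
rewrite /remaining_edges !remaining_prepend; apply/setP=> f.
apply/imset2P/imset2P => -[u v uA]; rewrite inE => /andP[vB uvE] ->;
  exists u v => //; rewrite inE vB /=.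
  apply/imset2P; exists u v => //; first exact: (subsetP (remaining_sub _ _ _) u uA).
  by rewrite inE uvE andbT; apply: (subsetP (remaining_sub _ _ _) v vB).
by case/imset2P: uvE => u' v' _; rewrite inE => /andP[_ uvE'] ->.
Qed.

Lemma avoiding_sub A B E a b :
  avoiding A B E a b \subset [set [set u; v] | u in A :\ a, v in B :\ b].
Proof.
apply/subsetP=> f /imset2P[u v uA]; rewrite inE => /andP[vB _] ->.
by apply/imset2P; exists u v.
Qed.

Section Removal.
Variables (A B : {set V}) (E : {set {set V}}) (a b : V).
Hypotheses (hAB : [disjoint A & B]) (hE : E \subset [set [set u; v] | u in A, v in B]).
Hypotheses (aA : a \in A) (bB : b \in B) (abE : [set a; b] \in E).

Lemma avoiding_matchingU1 M : is_matching (avoiding A B E a b) M ->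
  is_matching E ([set a; b] |: M) /\ [set a; b] \notin M.
Proof.
case/andP=> sub_M triv_M.
(* Disjointness of [A] and [B] rules out the crossed coincidences of an endpoint with [a] or [b].
   Nonemptiness is there because [trivIsetU1] asks that [set0] be absent from [M]. *)
have dis f : f \in M -> [disjoint [set a; b] & f] /\ f != set0.
  move=> /(subsetP sub_M)/imset2P[u v /setD1P[neq_ua uA]].
  rewrite inE => /andP[/setD1P[neq_vb vB] _] ->.
  have dAB x y : x \in A -> y \in B -> x != y.
    by move=> xA yB; apply: contraTneq yB => <-; rewrite (disjointFr hAB).
  split; last by apply/set0Pn; exists u; rewrite !inE eqxx.
  rewrite disjoint_sym disjoints_subset; apply/subsetP=> x.
  rewrite !inE => /orP[] /eqP->; rewrite negb_or.
    by rewrite neq_ua dAB.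
  by rewrite neq_vb andbT eq_sym dAB.
have [|||triv_abM ab_notin] := @trivIsetU1 _ [set a; b] M.
- by move=> f /dis[].
- exact: triv_M.
- by apply/negP=> /dis[_]; rewrite eqxx.
split=> //; rewrite /is_matching triv_abM andbT subUset sub1set abE /=.
apply/subsetP=> f /(subsetP sub_M) /imset2P[u v _].
by rewrite inE => /andP[_ uvE] ->.
Qed.

Lemma avoiding_matchingD1 M : is_matching E M -> [set a; b] \in M ->
  is_matching (avoiding A B E a b) (M :\ [set a; b]).
Proof.
case/andP=> sub_M triv_M abM.
rewrite /is_matching (trivIsetS (subsetDl _ _) triv_M) andbT.
apply/subsetP=> f /setD1P[neq_f fM].
have fE := subsetP sub_M f fM.
have /imset2P[u v uA vB f_uv] := subsetP hE f fE.
have dis : [disjoint f & [set a; b]] by apply: (trivIsetP triv_M).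
have f_avoids x : x \in [set a; b] -> x \notin f.
  by move=> x_ab; rewrite (disjointFl dis).
apply/imset2P; exists u v => //.
  rewrite in_setD1 uA andbT; apply: contraTneq (f_avoids a _) => [<-|]; last by rewrite !inE eqxx.
  by rewrite f_uv !inE eqxx.
rewrite inE -f_uv fE andbT in_setD1 vB andbT.
apply: contraTneq (f_avoids b _) => [<-|]; last by rewrite !inE eqxx orbT.
by rewrite f_uv !inE eqxx orbT.
Qed.

(** Deleting the edge from [M] gives one inequality, adding it to an MCM of the smaller graph gives
    the other. *)
Lemma mcm_card_avoiding M : M \in mcms E -> [set a; b] \in M ->
  mcm_card E = (mcm_card (avoiding A B E a b)).+1.
Proof.
move=> mcmM abM; apply/eqP; rewrite eqn_leq; apply/andP; split.
  rewrite -(mcms_card mcmM) (cardsD1 [set a; b]) abM ltnS.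
  exact/leq_mcm_card/avoiding_matchingD1/abM/mcms_matching.
have [M' mcmM'] := mcms_exists (avoiding A B E a b).
have [matU notinM'] := avoiding_matchingU1 (mcms_matching mcmM').
by rewrite -(mcms_card mcmM') -add1n; move: (leq_mcm_card matU); rewrite cardsU1 notinM'.
Qed.

Lemma avoiding_mcmsD1 M : M \in mcms E -> [set a; b] \in M ->
  M :\ [set a; b] \in mcms (avoiding A B E a b).
Proof.
move=> mcmM abM; rewrite inE avoiding_matchingD1 ?mcms_matching //=.
move: (mcm_card_avoiding mcmM abM); rewrite -(mcms_card mcmM) (cardsD1 [set a; b]) abM add1n.
by case=> ->.
Qed.

Lemma avoiding_mcmsU1 M M' : M \in mcms E -> [set a; b] \in M ->
  M' \in mcms (avoiding A B E a b) -> [set a; b] |: M' \in mcms E.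
Proof.
move=> mcmM abM mcmM'.
have [matU notinM'] := avoiding_matchingU1 (mcms_matching mcmM').
by rewrite inE matU cardsU1 notinM' (mcms_card mcmM') (mcm_card_avoiding mcmM abM) /=.
Qed.

End Removal.
End Remaining.

(** * Lexicographic minimisers solve SeqBAP *)

Section LexMinimal.
Local Open Scope ring_scope.
Variables (R : realType) (V : finType) (w : {set V} -> R).
Implicit Types (A B : {set V}) (E M : {set {set V}}).

Definition lex_minimal E M : Prop :=
  M \in mcms E /\ forall M', M' \in mcms E ->
    (ordered_weights w M <= ordered_weights w M' :> seqlexi R)%O.

Lemma is_LexBAP_lex_minimal E M : is_LexBAP E w M <-> lex_minimal E M.
Proof.
split=> -[mcmM minM]; split=> // M' mcmM'.
all: have sz : size (ordered_weights w M) = size (ordered_weights w M')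
  by rewrite !size_ordered_weights !(@mcms_card _ E).
all: have := seqlexi_leP sz; rewrite size_ordered_weights (mcms_card mcmM) => lexP.
  by apply/lexP => /(minM _ mcmM').
by apply/lexP/minM.
Qed.

(** A finite nonempty set of MCMs has a minimiser for tuples under a total order. *)
Lemma lex_minimal_exists E : exists M, lex_minimal E M.
Proof.
have [M0 mcmM0] := mcms_exists E.
case: (@Order.TotalTheory.arg_minP _ (seqlexi R) _ M0 (mem (mcms E))
         (ordered_weights w) mcmM0) => M mcmM minM.
by exists M.
Qed.

(** The head of the ordered tuple is the largest weight, and a lexicographic inequality includes the
    inequality of heads. *)
Lemma lex_minimal_bottleneck E M : M != set0 -> lex_minimal E M ->
  M \in bottleneck_mcms w E.
Proof.
move=> M_neq0 [mcmM minM]; rewrite inE mcmM; apply/forall_inP=> M' mcmM'.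
have M'_neq0 : M' != set0.
  by rewrite -card_gt0 (mcms_card mcmM') -(mcms_card mcmM) card_gt0.
have [e he] := heaviest_edge_exists w M_neq0.
have [e' he'] := heaviest_edge_exists w M'_neq0.
rewrite (max_weight_heaviest he) (max_weight_heaviest he') lee_fin.
have := minM _ mcmM'.
rewrite (ordered_weights_heaviest he) (ordered_weights_heaviest he').
by rewrite Order.SeqLexiOrder.lexi_cons => /andP[].
Qed.

Lemma lex_minimal_avoiding A B E M a b : [disjoint A & B] ->
  E \subset [set [set u; v] | u in A, v in B] -> a \in A -> b \in B ->
  lex_minimal E M -> [set a; b] \in heaviest_edges w M ->
  lex_minimal (avoiding A B E a b) (M :\ [set a; b]).
Proof.
move=> hAB hE aA bB [mcmM minM] hab.
have [abM le_ab] := heaviest_edgesP _ _ _ hab.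
have abE : [set a; b] \in E by case/andP: (mcms_matching mcmM) => /subsetP->.
have mcmD := avoiding_mcmsD1 hAB hE aA bB abE mcmM abM.
split=> // M' mcmM'.
have mcmU := avoiding_mcmsU1 hAB hE aA bB abE mcmM abM mcmM'.
have [_ notinM'] := avoiding_matchingU1 hAB aA bB abE (mcms_matching mcmM').
(* If [M] is the single edge, the remaining tuple is empty and hence least. *)
have [D_eq0|/heaviest_edge_exists-/(_ R w)[f hf]] := eqVneq (M :\ [set a; b]) set0.
  have -> : ordered_weights w (M :\ [set a; b]) = [::].
    by apply: size0nil; rewrite size_ordered_weights D_eq0 cards0.
  exact: Order.SeqLexiOrder.lexi0s.
have [/setD1P[_ fM] _] := heaviest_edgesP _ _ _ hf.
have M'_neq0 : M' != set0.
  rewrite -card_gt0 (mcms_card mcmM') -(mcms_card mcmD) card_gt0.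
  by apply/set0Pn; exists f; case/heaviest_edgesP: hf.
have [e' he'] := heaviest_edge_exists w M'_neq0.
have [e'M' le_e'] := heaviest_edgesP _ _ _ he'.
(* The exchange: when [[set a; b]] stays heaviest after joining [M'], both tuples share their head,
   and minimality of [M] passes to the tails. *)
have [le_e'_ab | lt_ab_e'] := leP (w e') (w [set a; b]).
  have hU : [set a; b] \in heaviest_edges w ([set a; b] |: M').
    apply/heaviest_edgesP; split; first exact: setU11.
    by move=> g /setU1P[-> // | /le_e' le_g]; apply: le_trans le_g le_e'_ab.
  move: (minM _ mcmU).
  rewrite (ordered_weights_heaviest hab) (ordered_weights_heaviest hU).
  by rewrite setU1K // Order.SeqLexiOrder.lexi_cons !lexx.
(* Otherwise [w f <= w [set a; b] < w e'], so the heads already decide. *)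
rewrite (ordered_weights_heaviest hf) (ordered_weights_heaviest he').
have lt_f_e' := le_lt_trans (le_ab f fM) lt_ab_e'.
by rewrite Order.SeqLexiOrder.lexi_cons (ltW lt_f_e') leNgt lt_f_e'.
Qed.

(* x0 only provides values for the labels past the end. *)
Lemma lex_minimal_SeqBAP (x0 : V) A B E M : [disjoint A & B] ->
  E \subset [set [set u; v] | u in A, v in B] ->
  lex_minimal E M -> is_SeqBAP A B E w M.
Proof.
(* The induction on [#|M|] generalises the vertex sets and the edge set, since the graph shrinks
   along with [M]. *)
move: {2}#|M| (erefl #|M|) => n; elim: n A B E M => [|n IHn] A B E M cardM hAB hE lexM.
  have [mcmM _] := lexM; split=> //.
  have card0 : mcm_card E = 0%N by rewrite -(mcms_card mcmM).
  exists (fun=> x0), (fun=> x0), (fun=> set0); rewrite card0; split=> //.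
  by rewrite (cards0_eq cardM); apply/setP=> f; rewrite inE; apply/esym/imsetP=> -[[]].
have [mcmM _] := lexM.
have M_neq0 : M != set0 by rewrite -card_gt0 cardM.
have [e he] := priciest_edge_exists w E M_neq0.
have he' : e \in heaviest_edges w M by move: he; rewrite inE => /andP[].
have [eM _] := heaviest_edgesP _ _ _ he'.
have eE : e \in E by case/andP: (mcms_matching mcmM) => /subsetP->.
have /imset2P[a b aA bB e_ab] := subsetP hE e eE; subst e.
have lexM1 := lex_minimal_avoiding hAB hE aA bB lexM he'.
have cardM1 : #|M :\ [set a; b]| = n by move: cardM; rewrite (cardsD1 [set a; b]) eM add1n => -[].
have hAB1 : [disjoint A :\ a & B :\ b].
  exact: disjointWl (subsetDl _ _) (disjointWr (subsetDl _ _) hAB).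
have [_ [i [j [Mk [M1E step]]]]] :=
  IHn _ _ _ _ cardM1 hAB1 (avoiding_sub A B E a b) lexM1.
split=> //.
have cardE1 : mcm_card (avoiding A B E a b) = n by rewrite -(mcms_card lexM1.1).
have cardE : mcm_card E = n.+1 by rewrite -(mcms_card mcmM).
(* [M] itself is the bottleneck matching of step 0; the later ones come from the smaller graph,
   shifted by one. *)
exists (prepend a i), (prepend b j), (fun k => if k is k'.+1 then Mk k' else M).
rewrite cardE; rewrite cardE1 in M1E step; split=> [|[|k] lt_k] /=.
- rewrite -(setD1K eM) M1E; apply/setP=> f; apply/setU1P/imsetP.
    case=> [-> | /imsetP[k _ ->]]; first by exists ord0.
    by exists (lift ord0 k).
  case=> k _ ->; case: (unliftP ord0 k) => [k' -> | ->]; last by left.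
  by right; apply/imsetP; exists k'.
- rewrite remaining_edges0 //; split=> //.
  exact: lex_minimal_bottleneck.
- have [iA jB Mk_bot ij_pricy] := step k lt_k.
  rewrite remaining_edges_prepend.
  by split=> //; [move: iA | move: jB]; case/setD1P.
Qed.

End LexMinimal.

Theorem corollary4 (R : realType) (V : finType) (A B : {set V})
    (E : {set {set V}}) (w : {set V} -> R) (M : {set {set V}})
    (hAB : [disjoint A & B])
    (hE : E \subset [set [set a; b] | a in A, b in B])
    (hE0 : E != set0)
    (hM : M \in mcms E)
    (hSeq : unique (is_SeqBAP A B E w) M) :
  unique (is_LexBAP E w) M.
Proof.
have [_ uniqM] := hSeq.
(* An endpoint of some edge provides the default label. *)
have [x0 _] : exists x : V, x \in A.
  by case/set0Pn: hE0 => e /(subsetP hE)/imset2P[a b aA _ _]; exists a.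
have lexM M' : is_LexBAP E w M' -> M = M'.
  by move=> /is_LexBAP_lex_minimal/(lex_minimal_SeqBAP x0 hAB hE)/uniqM.
split=> //.
(* That [M] solves LexBAP is obtained indirectly: some [M0] does, and [lexM] identifies it with
   [M]. *)
have [M0 /is_LexBAP_lex_minimal lexM0] := lex_minimal_exists w E.
by rewrite (lexM _ lexM0).
Qed.
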